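(* There exists an effectively computable constant $c_p>0$, depending at most on the prime $p\ge3$, such that for any finite field $\mathbb{F}$ of characteristic $p$, any nontrivial additive character $\psi$ on $\mathbb{F}$ and any $\alpha\in\mathbb{F}^\times$, $$|\theta_{\mathbb{F}}(\psi;\alpha)|>|\mathbb{F}|^{-c_p}\quad\text{and}\quad|\pi-\theta_{\mathbb{F}}(\psi;\alpha)|>|\mathbb{F}|^{-c_p}.$$ Moreover, $c_p=2(p-1)$ is a suitable value.
   Context: $\psi$ takes values in $\mathbb{Q}(\zeta_p)$, viewed in $\mathbb{C}$ via a fixed complex embedding. The Kloosterman sum $\mathrm{Kl}_{\mathbb{F}}(\psi;\alpha)=-\sum_{x\in\mathbb{F}^\times}\psi(x+\alpha/x)$ is a real number with $|\mathrm{Kl}_{\mathbb{F}}(\psi;\alpha)|\le2|\mathbb{F}|^{1/2}$, and $\theta_{\mathbb{F}}(\psi;\alpha)\in[0,\pi]$ is the unique angle with $\mathrm{Kl}_{\mathbb{F}}(\psi;\alpha)=2|\mathbb{F}|^{1/2}\cos\theta_{\mathbb{F}}(\psi;\alpha)$. *)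

(* Defs.v *)
From HB Require Import structures.
From mathcomp Require Import all_boot all_order all_algebra all_field.
From mathcomp Require Import all_classical all_reals all_analysis.
From mathcomp.real_closed Require Import complex.
Set Implicit Arguments. Unset Strict Implicit. Unset Printing Implicit Defensive.
Import Order.TTheory GRing.Theory Num.Theory.
Local Open Scope ring_scope.
Local Open Scope complex_scope.

Definition additive_character (R : realType) (F : finFieldType)
    (psi : F -> R[i]) : Prop :=
  psi 0 = 1 /\ forall x y : F, psi (x + y) = psi x * psi y.

Definition nontrivial_character (R : realType) (F : finFieldType)
    (psi : F -> R[i]) : Prop :=
  exists x : F, psi x != 1.

Definition Kloosterman (R : realType) (F : finFieldType)
    (psi : F -> R[i]) (alpha : F) : R[i] :=
  - \sum_(x : F | x != 0) psi (x + alpha / x).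

(* theta_F(psi; alpha) in [0, pi] with Kl = 2 |F|^{1/2} cos theta
   (Kl is real; we take its real part). *)
Definition kl_angle (R : realType) (F : finFieldType)
    (psi : F -> R[i]) (alpha : F) : R :=
  acos (complex.Re (Kloosterman psi alpha) / (2 * Num.sqrt (#|F|%:R))).

(* Main.v *)
Require Import Defs.
From HB Require Import structures.
From mathcomp Require Import all_boot all_order all_algebra all_field.
From mathcomp Require Import all_classical all_reals all_analysis.
From mathcomp.real_closed Require Import complex.
From mathcomp Require Import ring lra zify.
Set Implicit Arguments. Unset Strict Implicit. Unset Printing Implicit Defensive.
Import Order.TTheory GRing.Theory Num.Theory numFieldNormedType.Exports.
Local Open Scope ring_scope.

(** The heart of the matter is Weil's bound [|Kl| <= 2 sqrt q]; without it the
    angle would not even be defined.  Let [S] be the character sum [- Kl].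

    - Counting the elements of the quadratic extension [E] of [F] with given
      trace and norm, together with the pairs of elements of [F] with given sum
      and product, one finds two in all; hence the sum attached to
      [psi \o Tr] over [E] is [2 q - S ^ 2].  Iterating this, any bound
      [S = O(sqrt q)] that is uniform over the extensions of [F] improves to
      [|S| <= 2 sqrt q].
    - Such a bound comes from Stepanov's method over fields with [Q ^ 2]
      elements, [Q = p ^ (m + 1)]: put [g = c x + d / x] and
      [u = g + g ^ p + ... + g ^ (p ^ m)], so that the trace of [g] to the prime
      field is [u + u ^ Q].  A nonzero polynomial in [x] and [u] of small degree
      whose [Q]-th power vanishes wherever [u + u ^ Q = t] bounds the number of
      such points by [q / p + O(sqrt q)].  As the classes [t] add up to [q - 1],
      all of these numbers are [q / p + O(sqrt q)].

    Finally [4 q - Kl ^ 2] is the value at [zeta_p] of some [P] in [Z[X]].  The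
    product of the values of [P] at all [p]-th roots of unity is the determinant
    of an integer circulant matrix, and it is prime to [p] because [P(1)] is.  By
    Weil's bound the factors other than [P(1)] lie between [0] and [4 q], so
    [4 q - Kl ^ 2] is not too small.  This bounds [sin theta] from below, and
    [theta] and [pi - theta] are at least [sin theta]. *)

(** * Quadratic extensions of finite fields *)

Lemma exprD_pchar_pow (R : comNzRingType) (p n : nat) (x y : R) :
  p \in [pchar R] -> (x + y) ^+ (p ^ n) = x ^+ (p ^ n) + y ^+ (p ^ n).
Proof.
move=> pR; apply: exprDn_pchar.
by rewrite (eq_pnat _ (pcharf_eq pR)) pnatX pnat_id ?(pcharf_prime pR).
Qed.

Lemma expr_sum_pchar_pow (R : comNzRingType) (p n : nat) (I : Type)
    (r : seq I) (P : pred I) (f : I -> R) :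
  p \in [pchar R] ->
  (\sum_(i <- r | P i) f i) ^+ (p ^ n) = \sum_(i <- r | P i) f i ^+ (p ^ n).
Proof.
move=> pR.
have p0 : (0 < p ^ n)%N by rewrite expn_gt0 prime_gt0 ?(pcharf_prime pR).
apply: (big_morph (fun x => x ^+ (p ^ n))) => [x y|]; first exact: exprD_pchar_pow.
by rewrite expr0n eqn0Ngt p0.
Qed.

Lemma exprD_card (F : finFieldType) (R : comNzRingType) (x y : R) :
  [pchar R] =i [pchar F] -> (x + y) ^+ #|F| = x ^+ #|F| + y ^+ #|F|.
Proof.
move=> eR; have [p _ pF] := finPcharP F.
by rewrite (card_pprimeChar pF) exprD_pchar_pow // eR.
Qed.

(** As [1 != -1], squaring is not injective on the finite set [F], so it misses some [e], and
    ['X^2 - e] is irreducible. *)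
Lemma quadratic_extension (F : finFieldType) :
  (2 : F) != 0 ->
  exists (E : finFieldType) (iota : {rmorphism F -> E}), #|E| = (#|F| ^ 2)%N.
Proof.
move=> F2.
have [e /forallP He] : exists e : F, [forall x : F, x ^+ 2 != e].
  apply/existsP; apply: contraT => /existsPn H.
  have {}H e : exists x : F, x ^+ 2 == e.
    by have := H e; rewrite negb_forall => /existsP[x /negPn]; exists x.
  pose g e := xchoose (H e).
  have gK : cancel g (fun x => x ^+ 2) by move=> e; apply/eqP/(xchooseP (H e)).
  have [h hg gh] := injF_bij (can_inj gK).
  have gX x : g (x ^+ 2) = x by rewrite -[x in LHS]gh gK gh.
  have : (1 : F) = -1 by rewrite -[LHS]gX -[RHS]gX sqrrN.
  by move/eqP; rewrite -addr_eq0; apply: contraLR.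
pose h : {poly F} := 'X^2 - e%:P.
have sh : size h = 3 by rewrite size_XnsubC.
have hI : monic_irreducible_poly h.
  split; last exact: monicXnsubC.
  apply: cubic_irreducible; rewrite ?sh // => x.
  by rewrite rootE !hornerE subr_eq0 He.
exists {poly %/ h with hI}, (qpolyC h).
by rewrite card_qfpoly sh.
Qed.

Section QuadraticTrace.

Variables (F E : finFieldType) (iota : {rmorphism F -> E}).
Hypothesis oE : #|E| = (#|F| ^ 2)%N.

(** With [q = #|F|], the polynomial ['X^q - 'X] has at most [q] roots, and the image of [iota]
    already supplies [q] of them. *)
Lemma frobenius_fixed (x : E) : x ^+ #|F| = x -> exists a, x = iota a.
Proof.
move=> xq; pose P : {poly E} := 'X^#|F| - 'X.
have sP : size P = #|F|.+1.
  by rewrite size_polyDl size_polyXn // size_polyN size_polyX ltnS finNzRing_gt1.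
have P0 : P != 0 by rewrite -size_poly_eq0 sP.
suff /existsP[a /eqP ->] : [exists a, x == iota a] by exists a.
apply: contraT => /existsPn H.
have := @max_poly_roots _ P (x :: [seq iota a | a : F]) P0.
rewrite sP /= size_image ltnn => -> //.
  rewrite rootE !hornerE xq subrr eqxx /=; apply/allP=> _ /fintype.imageP[a _ ->].
  by rewrite rootE !hornerE -rmorphXn expf_card subrr.
rewrite map_inj_uniq ?enum_uniq ?andbT; last exact: fmorph_inj.
by apply/fintype.imageP=> -[a _ xa]; have := H a; rewrite xa eqxx.
Qed.

Lemma frobeniusD (x y : E) : (x + y) ^+ #|F| = x ^+ #|F| + y ^+ #|F|.
Proof. by apply: exprD_card => p; exact: fmorph_pchar. Qed.

Lemma frobenius2 (x : E) : (x ^+ #|F|) ^+ #|F| = x.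
Proof. by rewrite -exprM mulnn -oE expf_card. Qed.

Fact trace_fixed (x : E) : exists a, x + x ^+ #|F| == iota a.
Proof.
have [|a ->] := @frobenius_fixed (x + x ^+ #|F|); last by exists a.
by rewrite frobeniusD frobenius2 addrC.
Qed.

Fact norm_fixed (x : E) : exists a, x * x ^+ #|F| == iota a.
Proof.
have [|a ->] := @frobenius_fixed (x * x ^+ #|F|); last by exists a.
by rewrite exprMn frobenius2 mulrC.
Qed.

Definition qtrace x := xchoose (trace_fixed x).
Definition qnorm x := xchoose (norm_fixed x).

Lemma qtraceE x : iota (qtrace x) = x + x ^+ #|F|.
Proof. exact/esym/eqP/(xchooseP (trace_fixed x)). Qed.

Lemma qnormE x : iota (qnorm x) = x * x ^+ #|F|.
Proof. exact/esym/eqP/(xchooseP (norm_fixed x)). Qed.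

Lemma qtraceD x y : qtrace (x + y) = qtrace x + qtrace y.
Proof.
by apply: (fmorph_inj iota); rewrite rmorphD !qtraceE frobeniusD addrACA.
Qed.

Lemma qtrace0 : qtrace 0 = 0.
Proof. by apply: (@addrI _ (qtrace 0)); rewrite -qtraceD !addr0. Qed.

Lemma qnorm_eq0 x : (qnorm x == 0) = (x == 0).
Proof.
rewrite -(fmorph_eq0 iota) qnormE mulf_eq0 expf_eq0.
by rewrite (ltnW (finNzRing_gt1 F)) orbb.
Qed.

(** This is [1 / x + 1 / x^q = (x + x^q) / (x * x^q)]. Through it the terms of a Kloosterman sum
    over [E] depend only on the trace and norm of [x]. *)
Lemma qtrace_div (a : F) x : x != 0 ->
  qtrace (iota a / x) = a * qtrace x / qnorm x.
Proof.
move=> x0; apply: (fmorph_inj iota).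
rewrite qtraceE !rmorphM fmorphV qtraceE qnormE exprMn exprVn -rmorphXn expf_card.
have xq0 : x ^+ #|F| != 0 by rewrite expf_neq0.
by move: (x ^+ _) xq0 => y y0; field; rewrite x0 y0.
Qed.

(** Otherwise ['X^q + 'X] would have [q ^ 2] roots. *)
Lemma qtrace_nonzero : exists x, qtrace x != 0.
Proof.
apply/existsP; apply: contraT => /existsPn H.
pose P : {poly E} := 'X^#|F| + 'X.
have sP : size P = #|F|.+1.
  by rewrite size_polyDl size_polyXn // size_polyX ltnS finNzRing_gt1.
have P0 : P != 0 by rewrite -size_poly_eq0 sP.
have rP : all (root P) (enum E).
  apply/allP => x _; rewrite rootE !hornerE addrC -qtraceE.
  by have := H x; rewrite negbK => /eqP->; rewrite rmorph0.
have := max_poly_roots P0 rP (enum_uniq _); rewrite sP -cardE oE ltnS.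
by rewrite -[X in (_ <= X)%N]expn1 leq_exp2l ?finNzRing_gt1.
Qed.

Lemma qtrace_iota_mul (a : F) x : qtrace (iota a * x) = a * qtrace x.
Proof.
apply: (fmorph_inj iota); rewrite rmorphM !qtraceE exprMn -rmorphXn expf_card.
by rewrite mulrDr.
Qed.

Lemma qtrace_surj (a : F) : exists x, qtrace x = a.
Proof.
have [x x0] := qtrace_nonzero; exists (iota (a / qtrace x) * x).
by rewrite qtrace_iota_mul mulfVK.
Qed.

End QuadraticTrace.

(** * Kloosterman sums over a quadratic extension *)

Section QuadraticCount.

Variables (F E : finFieldType) (iota : {rmorphism F -> E}).
Hypothesis oE : #|E| = (#|F| ^ 2)%N.
Let tr := qtrace iota oE.
Let nm := qnorm iota oE.

Let inert (u : F * F) := [set x : E | (tr x, nm x) == u].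
Let decomp (u : F * F) := [set v : F * F | (v.1 + v.2, v.1 * v.2) == u].

(** Everything counted is a root in [E] of [Z^2 - s Z + d], a pair being represented by its first
    entry. Frobenius sends a root [x] from [inert] to [s - x] and fixes the roots from [decomp]. *)
Lemma quadratic_count_le u : (#|inert u| + #|decomp u| <= 2)%N.
Proof.
case: u => s d; set A := inert _; set B := decomp _.
pose B' := [set iota v.1 | v in B].
have -> : #|B| = #|B'|.
  rewrite card_in_imset // => -[x y] [x' y']; rewrite !inE /= !xpair_eqE.
  move=> /andP[/eqP <- _] /andP[/eqP e _] /fmorph_inj xx'.
  by move: e; rewrite xx' => /addrI ->.
pose Z x := x * x + iota d == iota s * x.
have ZA x : x \in A -> Z x /\ x ^+ #|F| = iota s - x.
  rewrite inE xpair_eqE /Z => /andP[/eqP <- /eqP <-].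
  rewrite qtraceE qnormE -mulrDr [_ * x]mulrC eqxx; split=> //.
  by rewrite addrC addKr.
have ZB x : x \in B' -> Z x /\ x ^+ #|F| = x.
  case/imsetP => -[v w]; rewrite inE xpair_eqE /= /Z => /andP[/eqP <- /eqP <-] ->.
  by rewrite -rmorphXn expf_card -!rmorphM -rmorphD mulrDl [w * v]mulrC.
have ZU x : x \in A :|: B' -> Z x.
  by rewrite finset.in_setU => /orP[/ZA|/ZB] [].
have Zr r z : Z r -> Z z -> (z == r) || (z == iota s - r).
  move=> /eqP Zr /eqP Zz; rewrite -subr_eq0 -[z == _ - _]subr_eq0 -mulf_eq0.
  have -> : (z - r) * (z - (iota s - r)) =
    (z * z + iota d - iota s * z) - (r * r + iota d - iota s * r) by ring.
  by rewrite Zr Zz !subrr.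
have [AB|[r]] := finset.set_0Vmem (A :&: B').
  rewrite -cardsUI AB cards0 addn0.
  have [->|[r rAB]] := finset.set_0Vmem (A :|: B'); first by rewrite cards0.
  apply: (@leq_trans #|[set r; iota s - r]|); last by rewrite cards2; case: eqP.
  apply/subset_leq_card/fintype.subsetP => z zAB; rewrite !inE.
  by apply: Zr; apply: ZU.
(* A common element satisfies [r = s - r]: it is a double root, hence the only one, and each set has
   at most one element. *)
rewrite inE => /andP[/ZA[Zrr rA] /ZB[_ rB]].
have s1 (S : {set E}) : (forall z, z \in S -> Z z) -> (#|S| <= 1)%N.
  move=> SZ; rewrite -(cards1 r); apply/subset_leq_card/fintype.subsetP => z /SZ.
  by rewrite inE => /(Zr _ _ Zrr); rewrite -rA rB orbb.
by rewrite -[2%N]/(1 + 1)%N leq_add // s1 // => z; [case/ZA|case/ZB].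
Qed.

(** Summed over all [u], the sets [inert u] partition [E] and the sets [decomp u] partition [F * F].
    The total [2 q ^ 2] leaves no room for a strict inequality at any [u]. *)
Lemma quadratic_count u : (#|inert u| + #|decomp u|)%N = 2%N.
Proof.
have H := leqif_sum (fun u (_ : true) => leqif_eq (quadratic_count_le u)).
suff e : (\sum_u (#|inert u| + #|decomp u|) = \sum_(u : F * F) 2)%N.
  by move: H.2; rewrite e eqxx => /esym/forallP/(_ u)/eqP.
rewrite big_split /= sum_nat_const card_prod muln2 -addnn; congr (_ + _)%N.
  rewrite mulnn -oE -sum1_card (partition_big (fun x => (tr x, nm x)) predT) //=.
  by apply: eq_bigr => v _; rewrite -sum1_card; apply: eq_bigl => x; rewrite inE.
rewrite -card_prod -sum1_card.
rewrite [RHS](partition_big (fun v => (v.1 + v.2, v.1 * v.2)) predT) //=.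
by apply: eq_bigr => v _; rewrite -sum1_card; apply: eq_bigl => x; rewrite inE.
Qed.

End QuadraticCount.

Definition is_char (C : nzRingType) (F : finFieldType) (psi : F -> C) :=
  psi 0 = 1 /\ forall x y, psi (x + y) = psi x * psi y.

Definition klsum (C : nzRingType) (F : finFieldType) (psi : F -> C) (a : F) : C :=
  \sum_(x | x != 0) psi (x + a / x).

Section CharacterSums.

Variables (C : fieldType) (F : finFieldType) (psi : F -> C).
Hypothesis psi_char : is_char psi.

Lemma charMn x n : psi (x *+ n) = psi x ^+ n.
Proof.
by elim: n => [|n IH]; rewrite ?psi_char.1 // mulrS exprS psi_char.2 IH.
Qed.

Lemma charN x : psi (- x) * psi x = 1.
Proof. by rewrite -psi_char.2 addNr psi_char.1. Qed.

Lemma char_pchar p x : p \in [pchar F] -> psi x ^+ p = 1.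
Proof.
by move=> pF; rewrite -charMn -mulr_natr pcharf0 // mulr0 psi_char.1.
Qed.

Lemma char_sum0 x : psi x != 1 -> \sum_y psi y = 0.
Proof.
move=> x1; apply/eqP.
have : (psi x - 1) * (\sum_y psi y) == 0.
  rewrite mulrBl mul1r subr_eq0 mulr_sumr; apply/eqP.
  rewrite [RHS](reindex_inj (addrI x)).
  by apply: eq_bigr => y _; rewrite psi_char.2.
by rewrite mulf_eq0 subr_eq0 (negPf x1).
Qed.

Lemma char_sumM x c : psi x != 1 ->
  \sum_y psi (y * c) = if c == 0 then #|F|%:R else 0.
Proof.
move=> x1; have [->|c0] := eqVneq.
  rewrite (eq_bigr (fun=> 1)) => [|y _]; last by rewrite mulr0 psi_char.1.
  by rewrite sumr_const.
rewrite -[RHS](char_sum0 x1) [RHS](reindex_inj (mulIf c0)).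
by apply: eq_bigr.
Qed.

(** Grouped by [u = (s, d)], both sums have the terms [f u = psi (s (1 + a / d))], with
    multiplicities adding up to 2. Summing over [s] first, orthogonality leaves only [d = - a],
    which contributes [q]. *)
Lemma klsum_quadratic (E : finFieldType) (iota : {rmorphism F -> E})
    (oE : #|E| = (#|F| ^ 2)%N) (a : F) x : psi x != 1 -> a != 0 ->
  klsum (psi \o qtrace iota oE) (iota a)
    = #|F|%:R *+ 2 - klsum psi a ^+ 2.
Proof.
move=> x1 a0; set tr := qtrace iota oE; pose nm := qnorm iota oE.
pose f (u : F * F) := psi (u.1 + a * u.1 / u.2).
have fE : klsum (psi \o tr) (iota a) =
    \sum_(u : F * F | u.2 != 0) f u *+ #|[set x : E | (tr x, nm x) == u]|.
  rewrite /klsum (partition_big (fun x => (tr x, nm x)) (fun u => u.2 != 0)) /=.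
    apply: eq_bigr => u u0; rewrite -sumr_const; apply: eq_big => [z|z].
      rewrite inE; case: ((tr z, nm z) =P u) => [uz|]; rewrite ?andbF // -(qnorm_eq0 iota oE).
      by move: u0; rewrite -uz /= -/nm => ->.
    move=> /andP[z0 /eqP <-].
    by rewrite /f /= /tr qtraceD qtrace_div.
  by move=> z z0; rewrite /nm qnorm_eq0.
have fF : klsum psi a ^+ 2 = \sum_(u : F * F | u.2 != 0)
     f u *+ #|[set v : F * F | (v.1 + v.2, v.1 * v.2) == u]|.
  rewrite expr2 /klsum mulr_suml.
  under eq_bigr do rewrite mulr_sumr.
  rewrite pair_big /=.
  rewrite (partition_big (fun v => (v.1 + v.2, v.1 * v.2)) (fun u => u.2 != 0)) /=.
    apply: eq_bigr => u u0; rewrite -sumr_const; apply: eq_big => [z|z].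
      rewrite inE -negb_or -mulf_eq0; case: (_ =P u) => [uz|]; rewrite ?andbF //.
      by move: u0; rewrite -uz /= => ->.
    move=> /andP[/andP[z0 z0'] /eqP <-].
    rewrite /f /= -psi_char.2; congr psi; field; exact/andP.
  by move=> v /andP[v1 v2] /=; rewrite mulf_neq0.
apply/eqP; rewrite eq_sym subr_eq eq_sym.
apply/eqP; rewrite fE fF -big_split /=.
transitivity (\sum_(u : F * F | u.2 != 0) f u *+ 2).
  apply: eq_bigr => u _; rewrite -mulrnDr; congr (_ *+ _).
  exact: quadratic_count.
rewrite sumrMnl; congr (_ *+ 2).
rewrite -(pair_big predT (fun d => d != 0) (fun s d => f (s, d))) /= exchange_big /=.
under eq_bigr => d d0.
  rewrite (eq_bigr (fun s => psi (s * (1 + a / d)))) => [|s _]; last first.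
    by rewrite /f /=; congr psi; ring.
  rewrite (char_sumM _ x1).
over.
have aN0 : - a != 0 by rewrite oppr_eq0.
rewrite (bigD1 (- a)) //= big1 => [|d /andP[d0 da]].
  by rewrite invrN mulrN divff // subrr eqxx addr0.
rewrite -[1](divff d0) -mulrDl mulf_eq0 invr_eq0 (negPf d0) orbF.
by rewrite addr_eq0 (negPf da).
Qed.

End CharacterSums.

(** * Stepanov's method *)

Lemma poly_dependent (K : fieldType) (I : finType) (P : I -> {poly K}) N :
    (forall i, (size (P i) <= N)%N) -> (N < #|I|)%N ->
  exists2 w : I -> K, exists i, w i != 0 & \sum_i w i *: P i = 0.
Proof.
move=> sP NI; pose A := \matrix_(i < #|I|, j < N) (P (enum_val i))`_j.
have : kermx A != 0.
  by rewrite kermx_eq0 -row_leq_rank -ltnNge (leq_ltn_trans (rank_leq_col _)).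
case/rowV0Pn => v /sub_kermxP vA v0; exists (fun i => v 0 (enum_rank i)).
  have /rV0Pn[j vj] := v0; exists (enum_val j); by rewrite enum_valK.
apply/polyP => j; rewrite coef0 coef_sum.
have [jN|Nj] := ltnP j N; last first.
  by rewrite big1 // => i _; rewrite coefZ nth_default ?mulr0 // (leq_trans (sP i)).
rewrite (reindex_onto enum_val enum_rank) /= => [|i _]; last by rewrite enum_rankK.
have /matrixP/(_ 0 (Ordinal jN)) := vA.
rewrite !mxE => e; rewrite -[RHS]e; apply: eq_big => [i|i _].
  by rewrite enum_valK eqxx.
by rewrite coefZ enum_valK mxE.
Qed.

(** The leading term of largest degree with nonzero weight cannot cancel. *)
Lemma poly_independent (K : fieldType) (I : finType) (P : I -> {poly K}) (w : I -> K) :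
    (forall i, P i != 0) -> injective (fun i => size (P i)) ->
  (exists i, w i != 0) -> \sum_i w i *: P i != 0.
Proof.
move=> P0 Pinj [i0 wi0].
case: (@arg_maxnP _ i0 (fun i => w i != 0) (fun i => size (P i)) wi0) => i wi Hi.
apply/eqP => S0; have := congr1 (fun p : {poly K} => p`_(size (P i)).-1) S0.
rewrite coef0 coef_sum (bigD1 i) //= big1 ?addr0 => [|j ji]; last first.
  have [->|wj] := eqVneq (w j) 0; first by rewrite scale0r coef0.
  rewrite coefZ nth_default ?mulr0 //.
  have sPi : (0 < size (P i))%N by rewrite size_poly_gt0.
  rewrite -ltnS (prednK sPi) ltn_neqAle (Hi _ wj : (size (P j) <= size (P i))%N) andbT.
  by apply: contra_neq ji => /Pinj.
by move/eqP; rewrite coefZ mulf_eq0 -lead_coefE lead_coef_eq0 (negPf (P0 i)) (negPf wi).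
Qed.

(** On a field with [p ^ n] elements this is the trace to the prime field. The length [n] is free
    because half of the trace is used as well. *)
Definition abs_trace (R : nzRingType) (p n : nat) (z : R) := \sum_(i < n) z ^+ (p ^ i).

Section Stepanov.

Variables (F : finFieldType) (p m : nat) (c d t : F).
Hypotheses (pF : p \in [pchar F]) (oF : #|F| = (p ^ (m.+1 + m.+1))%N).
Hypotheses (m_gt0 : (0 < m)%N) (c0 : c != 0).

Let D := (p ^ m)%N.
Let Q := (p * D)%N.
Let u x := abs_trace p m.+1 (c * x + d / x).
(** The numerator of [u] over the denominator ['X^D]. The subtraction [D - p ^ i] does not truncate,
    since [i <= m]. *)
Let U : {poly F} :=
  \sum_(i < m.+1) (c ^+ (p ^ i) *: 'X^(D + p ^ i) + d ^+ (p ^ i) *: 'X^(D - p ^ i)).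

Let p_gt1 : (1 < p)%N. Proof. exact/prime_gt1/(pcharf_prime pF). Qed.
Let p_gt0 : (0 < p)%N. Proof. exact: ltnW. Qed.
Let D_gt1 : (1 < D)%N. Proof. by rewrite -(exp1n m) ltn_exp2r. Qed.
Let D_gt0 : (0 < D)%N. Proof. exact: ltnW. Qed.
Let QE : Q = (p ^ m.+1)%N. Proof. by rewrite /Q /D expnS. Qed.

Let exprQQ (x : F) : (x ^+ Q) ^+ Q = x.
Proof. by rewrite -exprM QE -expnD -oF expf_card. Qed.

Let size_U : size U = (2 * D).+1.
Proof.
have sz i (a : F) n : (n < i)%N -> (size (a *: 'X^n) <= i)%N.
  by move=> ni; apply: leq_trans (size_scale_leq _ _) _; rewrite size_polyXn.
rewrite /U big_ord_recr /= addrA addrAC addnn -mul2n.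
have sc : size (c ^+ D *: 'X^(2 * D)) = (2 * D).+1.
  by rewrite size_scale ?expf_neq0 // size_polyXn.
rewrite addrC -/D size_polyDl sc // ltnS.
apply: leq_trans (size_polyD _ _) _; rewrite geq_max; apply/andP; split; last first.
  by apply: sz; rewrite subnn muln_gt0.
apply: leq_trans (size_sum _ _ _) _; apply/bigmax_leqP => i _.
have piD : (p ^ i < D)%N by rewrite ltn_exp2l.
apply: leq_trans (size_polyD _ _) _; rewrite geq_max; apply/andP; split.
  by apply: sz; rewrite mul2n -addnn ltn_add2l.
by apply: sz; rewrite mul2n -addnn (leq_ltn_trans (leq_subr _ _)) // -[X in (X < _)%N]addn0
  ltn_add2l.
Qed.

Let horner_U x : x != 0 -> U.[x] = x ^+ D * u x.
Proof.
move=> x0; rewrite /U horner_sum mulr_sumr; apply: eq_bigr => i _.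
rewrite exprD_pchar_pow // !hornerE !exprMn exprVn exprD mulrDr.
congr (_ + _); first by rewrite mulrCA.
rewrite expfB_cond ?(negPf x0) //; last by rewrite add0n leq_exp2l // -ltnS.
by rewrite mulrCA.
Qed.

Let I := ('I_D * 'I_D.+1 * 'I_p)%type.

(* At a solution [x] of [u x + u x ^+ Q = t] the [Q]-th power of [frobP i] and
   [redP i] agree up to a factor that does not depend on [i], because
   [x ^+ (Q * Q) = x] and [u x ^+ Q = t - u x].  The [frobP i] have distinct
   degrees, but there are too many [redP i] for their degrees, so they satisfy a
   linear relation: this yields the auxiliary polynomial. *)
Let frobP (i : I) := 'X^(i.1.1 + Q * i.1.2) * U ^+ i.2 * 'X^((p.-1 - i.2) * D).
Let redP (i : I) :=
  'X^(Q * i.1.1 + i.1.2) * (t *: 'X^D - U) ^+ i.2 * 'X^((p.-1 - i.2) * D).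

Let U0 : U != 0. Proof. by rewrite -size_poly_eq0 size_U. Qed.

Let size_frobP i :
  size (frobP i) = (i.1.1 + D * (i.2 + p * i.1.2) + p.-1 * D).+1.
Proof.
case: i => [[k a] b]; rewrite /frobP /=.
have Ub : U ^+ b != 0 by rewrite expf_neq0.
have sUb : size (U ^+ b) = (2 * D * b).+1.
  by rewrite -[LHS]prednK ?size_poly_gt0 // size_exp size_U.
have := ltn_ord b; rewrite -[X in (_ < X)%N](prednK p_gt0) ltnS => bp.
rewrite mulrAC -exprD mulrC size_mulXn // sUb addnS.
move: (p.-1) bp => r br; rewrite /Q; congr _.+1.
rewrite -[in RHS](subnK br); move: (r - b)%N => r'; nia.
Qed.

(** Up to a constant, the size is a mixed-radix expansion: [i.1.1] is the digit in base [D], then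
    [i.2] the digit in base [p], and [i.1.2] the remaining quotient. *)
Let frobP_inj : injective (fun i => size (frobP i)).
Proof.
move=> [[k a] b] [[k' a'] b']; rewrite !size_frobP /= => /succn_inj /addIn e.
have := congr1 (modn^~ D) e; have := congr1 (divn^~ D) e.
rewrite ![(_ + D * _)%N]addnC ![(D * _)%N]mulnC !modnMDl !divnMDl // !modn_small //.
rewrite !divn_small // !addn0 => e1 ek.
have := congr1 (modn^~ p) e1; have := congr1 (divn^~ p) e1.
rewrite ![(_ + p * _)%N]addnC ![(p * _)%N]mulnC !modnMDl !divnMDl // !modn_small //.
rewrite !divn_small // !addn0 => ea eb.
by congr (_, _, _); apply: val_inj.
Qed.

Let size_redP i : (size (redP i) <= Q * D + Q - D + 1)%N.
Proof.
case: i => [[k a] b]; rewrite /redP /=.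
set V := t *: 'X^D - U.
have sV : (size V <= (2 * D).+1)%N.
  apply: leq_trans (size_polyD _ _) _; rewrite size_polyN size_U geq_max leqnn andbT.
  apply: leq_trans (size_scale_leq _ _) _.
  by rewrite size_polyXn ltnS mul2n -addnn leq_addr.
have sVb : (size (V ^+ b) <= (2 * D * b).+1)%N.
  apply: leq_trans (size_poly_exp_leq _ _) _.
  by rewrite ltnS leq_mul2r; apply/orP; right; move: sV; case: (size V).
have bp := ltn_ord b; have kD := ltn_ord k; have aD := ltn_ord a.
rewrite mulrAC -exprD mulrC.
apply: leq_trans (size_polyMleq _ _) _; rewrite size_polyXn addnS /=.
have {}bp : (b <= p.-1)%N by rewrite -ltnS prednK.
have QrD : (Q = p.-1 * D + D)%N by rewrite /Q -[in LHS](prednK p_gt0) mulSnr.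
have rD : ((p.-1 - b) * D + b * D = p.-1 * D)%N by rewrite -mulnDl subnK.
have bD : (b * D <= p.-1 * D)%N by rewrite leq_mul2r bp orbT.
have kQ : (Q * k + Q <= Q * D)%N by rewrite addnC -mulnS leq_mul2l kD orbT.
apply: leq_trans (leq_add sVb (leqnn _)) _.
clear -QrD rD bD kQ aD D_gt0.
move: (p.-1) (Q * k)%N (Q * D)%N QrD rD bD kQ => r Qk QD; lia.
Qed.

Let redP_relation : exists2 w : I -> F, exists i, w i != 0 & \sum_i w i *: redP i = 0.
Proof.
(* There are [D (D + 1) p = Q D + Q] polynomials and [Q D + Q - D + 1] coefficients, which is fewer
   because [D > 1]. *)
apply: (poly_dependent size_redP); rewrite !card_prod !card_ord /Q.
nia.
Qed.

Lemma stepanov_half :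
  (#|[set x : F | (x != 0) && (u x + u x ^+ Q == t)]%R| <= Q * D + 2 * p * D)%N.
Proof.
have [w [i0 wi0] w_rel] := redP_relation.
(* The weights are [Q]-th powers so that the [Q]-th power of [s] has the weights [w i] again. *)
pose s := \sum_i w i ^+ Q *: frobP i.
have s0 : s != 0.
  apply: (@poly_independent _ _ _ (fun i => w i ^+ Q)) => //.
    by move=> i; rewrite -size_poly_eq0 size_frobP.
  by exists i0; rewrite expf_neq0.
set S := [set x | _].
have sS : all (root s) (enum S).
  apply/allP => x; rewrite mem_enum inE => /andP[x0 /eqP xt].
  have uQ : u x ^+ Q = t - u x by rewrite -xt [u x + _]addrC addrK.
  have Q0 : (0 < Q)%N by rewrite muln_gt0 p_gt0.
  have xD : x ^+ (p.-1 * D) != 0 by rewrite expf_neq0.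
  have QP (y : F) : y ^+ Q = y ^+ (p ^ m.+1) by rewrite QE.
  (* The padding ['X^((p.-1 - i.2) * D)] completes the factor [x ^+ (D * i.2)] from [U ^+ i.2] to
     [x ^+ (p.-1 * D)], whatever [i] is. *)
  have key i : (frobP i).[x] ^+ Q * x ^+ (p.-1 * D)
      = (redP i).[x] * (x ^+ (p.-1 * D)) ^+ Q.
    case: i => [[k a] b]; rewrite /frobP /redP !hornerE /= horner_U //.
    rewrite -[t * _]mulrC -mulrBr -uQ.
    have -> : (p.-1 * D = D * b + (p.-1 - b) * D)%N.
      rewrite [(D * _)%N]mulnC -mulnDl subnKC // -ltnS prednK //; exact: ltn_ord.
    rewrite !exprD !exprMn -!exprM.
    have -> : x ^+ (Q * a * Q) = x ^+ a by rewrite mulnAC exprM exprM exprQQ.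
    rewrite [(k * Q)%N]mulnC -[(D * b * Q)%N]mulnA [(b * Q)%N]mulnC.
    ring.
  suff : s.[x] ^+ Q * x ^+ (p.-1 * D) == 0.
    by rewrite mulf_eq0 (negPf xD) orbF expf_eq0 Q0.
  rewrite QP /s horner_sum expr_sum_pchar_pow // mulr_suml.
  have e : (\sum_i w i *: redP i).[x] * (x ^+ (p.-1 * D)) ^+ Q = 0.
    by rewrite w_rel horner0 mul0r.
  apply/eqP; rewrite -[RHS]e horner_sum mulr_suml; apply: eq_bigr => i _.
  by rewrite !hornerZ exprMn -!QP exprQQ -!mulrA -key.
have := max_poly_roots s0 sS (enum_uniq _); rewrite -cardE => /ltnW/leq_trans; apply.
apply: leq_trans (size_sum _ _ _) _; apply/bigmax_leqP => i _.
apply: leq_trans (size_scale_leq _ _) _; rewrite size_frobP.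
case: i => [[k a] b] /=; have kD := ltn_ord k; have aD := ltn_ord a; have bp := ltn_ord b.
have pD : (p = p.-1.+1)%N by rewrite prednK.
move: (k : nat) (a : nat) (b : nat) kD aD bp => {}k {}a {}b kD aD.
rewrite /Q; move: (p.-1) pD => r -> br; nia.
Qed.

(** The upper half of the Frobenius powers in the trace is the [Q]-th power of the lower half. *)
Lemma stepanov_bound :
  (#|[set x : F | (x != 0) && (abs_trace p (m.+1 + m.+1) (c * x + d / x) == t)]%R|
     <= Q * D + 2 * p * D)%N.
Proof.
apply: leq_trans stepanov_half; apply/eq_leq/eq_card => x; rewrite !inE.
congr (_ && (_ == _)); rewrite /u /abs_trace big_split_ord /=; congr (_ + _).
rewrite QE expr_sum_pchar_pow //; apply: eq_bigr => i _.
by rewrite -exprM -expnD addnC.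
Qed.

End Stepanov.

(** * Characters in terms of the absolute trace *)

Section AbsTrace.

Variables (F : finFieldType) (p n : nat).
Hypotheses (pF : p \in [pchar F]) (oF : #|F| = (p ^ n)%N).
Let T := @abs_trace F p n.

Lemma abs_traceD x y : T (x + y) = T x + T y.
Proof.
rewrite /T /abs_trace -big_split; apply: eq_bigr => i _; exact: exprD_pchar_pow.
Qed.

Lemma abs_trace0 : T 0 = 0.
Proof. by apply: (@addrI _ (T 0)); rewrite -abs_traceD !addr0. Qed.

Lemma abs_trace_frob x : T x ^+ p = T x.
Proof.
rewrite -[X in _ ^+ X]expn1 /T /abs_trace expr_sum_pchar_pow // expn1.
under eq_bigr do rewrite -exprM -expnSr.
have := finNzRing_gt1 F; rewrite oF; case: n oF => [|k] o; first by rewrite expn0.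
by move=> _; rewrite big_ord_recr [RHS]big_ord_recl /= -o expf_card expn0 expr1 addrC.
Qed.

Lemma abs_traceZ a x : a ^+ p = a -> T (a * x) = a * T x.
Proof.
move=> ap; rewrite /T /abs_trace mulr_sumr; apply: eq_bigr => i _.
rewrite exprMn; congr (_ * _); elim: (i : nat) => // j IH.
by rewrite expnSr exprM IH.
Qed.

(** The trace is given by a polynomial of degree [p ^ (n - 1)], too small to vanish on [F]. A
    nonzero value lies in the prime field, so it can be scaled to 1. *)
Lemma abs_trace_eq1 : exists x, T x = 1.
Proof.
suff [x Tx0] : exists x, T x != 0.
  exists ((T x)^-1 * x); rewrite abs_traceZ ?mulVf //.
  by rewrite exprVn abs_trace_frob.
apply/existsP; apply: contraT => /existsPn H.
have := finNzRing_gt1 F; rewrite oF.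
case: n oF @T H => [|k] o T' H; first by rewrite expn0.
move=> _; pose P : {poly F} := \sum_(i < k.+1) 'X^(p ^ i).
have p1 : (1 < p)%N := prime_gt1 (pcharf_prime pF).
have sP : size P = (p ^ k).+1.
  rewrite /P big_ord_recr /= addrC size_polyDl size_polyXn // ltnS.
  apply: leq_trans (size_sum _ _ _) _; apply/bigmax_leqP => i _.
  by rewrite size_polyXn ltn_exp2l.
have P0 : P != 0 by rewrite -size_poly_eq0 sP.
have rP : all (root P) (enum F).
  apply/allP => x _; rewrite rootE horner_sum.
  by under eq_bigr do rewrite hornerXn; have := H x; rewrite negbK.
have := max_poly_roots P0 rP (enum_uniq _); rewrite sP -cardE o ltnS.
by rewrite leq_exp2l ?ltnn.
Qed.

End AbsTrace.

Section Duality.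

Variables (C : numFieldType) (F : finFieldType) (p n : nat) (psi : F -> C) (z1 : F).
Hypotheses (pF : p \in [pchar F]) (oF : #|F| = (p ^ n)%N).
Hypotheses (psi_char : is_char psi) (z1N1 : psi z1 != 1).

(** The sums of [psi z * e (- c z)] over [z] add up to [q] over all [c], so one of them is nonzero.
    A character with nonzero sum is trivial, whence [psi z = e (c z)]. *)
Lemma char_dual :
  exists2 c, c != 0 & forall z, psi z = psi (z1 * abs_trace p n (c * z)).
Proof.
pose e v := psi (z1 * abs_trace p n v).
have e_char : is_char e.
  split; first by rewrite /e (abs_trace0 _ pF) mulr0 psi_char.1.
  by move=> x y; rewrite /e (abs_traceD _ pF) mulrDr psi_char.2.
have [z' Tz'] := abs_trace_eq1 pF oF.
have eN1 : e z' != 1 by rewrite /e Tz' mulr1.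
have sumq : \sum_c \sum_z psi z * e (c * - z) = #|F|%:R.
  rewrite exchange_big /=.
  under eq_bigr do rewrite -mulr_sumr (char_sumM e_char _ eN1) oppr_eq0.
  rewrite (bigD1 0) //= eqxx psi_char.1 mul1r big1 ?addr0 // => z /negPf ->.
  by rewrite mulr0.
have q0 : (#|F|%:R : C) != 0 by rewrite pnatr_eq0 -lt0n ltnW ?finNzRing_gt1.
have [c cN0] : exists c, \sum_z psi z * e (c * - z) != 0.
  apply/existsP; apply: contraNT q0 => /existsPn H.
  by rewrite -sumq big1 // => c _; apply/eqP; have := H c; rewrite negbK.
have chi_char : is_char (fun z => psi z * e (c * - z)).
  split; first by rewrite oppr0 mulr0 psi_char.1 e_char.1 mulr1.
  by move=> x y; rewrite opprD mulrDr psi_char.2 e_char.2 mulrACA.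
have pe z : psi z = e (c * z).
  have : psi z * e (c * - z) = 1.
    by apply/eqP; apply: contraNT cN0 => /(char_sum0 chi_char) ->.
  rewrite mulrN => /(congr1 (fun y => y * e (c * z))).
  by rewrite -mulrA (charN e_char) mulr1 mul1r.
exists c => //; apply: contra_neq z1N1 => c0.
by rewrite pe c0 mul0r e_char.1.
Qed.

Lemma char_norm x : `|psi x| = 1.
Proof.
have p0 : (0 < p)%N := prime_gt0 (pcharf_prime pF).
by apply/eqP; rewrite -(pexpr_eq1 p0) // -normrX (char_pchar psi_char _ pF) normr1.
Qed.

End Duality.

(** * A bound of the order of the square root *)

(** Stepanov's method bounds each class [N v] only from above, by [M]. As the [h v] add up to 0,
    minus the sum has the nonnegative multiplicities [M - N v], whose total is at most
    [p M - (q - 1)]. *)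
Lemma klsum_crude (C : numFieldType) (F : finFieldType) (p m : nat) (psi : F -> C)
    (z1 a : F) :
  p \in [pchar F] -> #|F| = (p ^ (m.+1 + m.+1))%N -> (0 < m)%N ->
  is_char psi -> psi z1 != 1 ->
  `|klsum psi a| <= (2 * p * p ^ m.+1 + 1)%N%:R.
Proof.
move=> pF oF m0 psi_char z1N1.
have [c c0 psiE] := char_dual pF oF psi_char z1N1.
pose T := @abs_trace F p (m.+1 + m.+1); pose g x := T (c * x + (c * a) / x).
(* The prime field, which contains all traces. *)
pose V := [set v : F | v ^+ p == v].
pose N v := #|[set x : F | (x != 0) && (g x == v)]|.
pose M := ((p * p ^ m) * p ^ m + 2 * p * p ^ m)%N.
pose h v := psi (z1 * v).
have NM v : (N v <= M)%N by exact: stepanov_bound.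
have p_gt1 : (1 < p)%N := prime_gt1 (pcharf_prime pF).
have cardV : (#|V| <= p)%N.
  pose P : {poly F} := 'X^p - 'X.
  have sP : size P = p.+1.
    by rewrite size_polyDl size_polyXn // size_polyN size_polyX ltnS.
  have P0 : P != 0 by rewrite -size_poly_eq0 sP.
  have := @max_poly_roots _ P (enum V) P0; rewrite sP -cardE; apply; last exact: enum_uniq.
  by apply/allP => x; rewrite mem_enum inE rootE !hornerE subr_eq0.
have gV x : g x \in V by rewrite inE (abs_trace_frob pF oF).
have hV : \sum_(v in V) h v = 0.
  apply/eqP; have : (psi z1 - 1) * (\sum_(v in V) h v) == 0.
    rewrite mulrBl mul1r subr_eq0 mulr_sumr; apply/eqP.
    rewrite [RHS](reindex_inj (addrI 1)) /=; apply: eq_big => v.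
      rewrite !inE -[p in RHS]expn1 exprD_pchar_pow // expn1 expr1n.
      by rewrite (inj_eq (addrI 1)).
    by move=> _; rewrite /h mulrDr mulr1 psi_char.2.
  by rewrite mulf_eq0 subr_eq0 (negPf z1N1).
have SE : klsum psi a = \sum_(v in V) h v *+ N v.
  rewrite /klsum (partition_big g (mem V)) //=; apply: eq_bigr => v _.
  rewrite -sumr_const; apply: eq_big => [x|x /andP[_ /eqP <-]]; first by rewrite inE.
  by rewrite psiE mulrDr mulrA.
have {}SE : - klsum psi a = \sum_(v in V) h v *+ (M - N v).
  have : \sum_(v in V) h v *+ M = 0 by rewrite sumrMnl hV mul0rn.
  move=> /(congr1 (fun y => y - klsum psi a)); rewrite sub0r => <-.
  rewrite SE -sumrB; apply: eq_bigr => v _; by rewrite mulrnBr.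
rewrite -normrN SE; apply: le_trans (ler_norm_sum _ _ _) _.
under eq_bigr do rewrite normrMn (char_norm pF psi_char).
rewrite -natr_sum ler_nat.
have sN : (\sum_(v in V) N v = #|F| - 1)%N.
  rewrite subn1 -(cardC1 (0 : F)) -sum1_card.
  rewrite [RHS](partition_big g (mem V)) //=; apply: eq_bigr => v _.
  by rewrite /N -sum1_card; apply: eq_bigl => x; rewrite !inE.
have : (\sum_(v in V) (M - N v) + (#|F| - 1) = #|V| * M)%N.
  rewrite -sN -big_split /= -sum_nat_const; apply: eq_bigr => v _; exact: subnK.
have : (#|V| * M <= p * M)%N by rewrite leq_mul2r cardV orbT.
have -> : (p * M = #|F| + 2 * p * p ^ m.+1)%N.
  by rewrite oF expnD expnS /M; ring.
have := finNzRing_gt1 F; lia.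
Qed.

(** * Weil's bound *)

Lemma quadratic_lift (C : numFieldType) (F : finFieldType) (p : nat)
    (psi : F -> C) (z1 a : F) :
  p \in [pchar F] -> (2 < p)%N -> is_char psi -> psi z1 != 1 -> a != 0 ->
  exists (E : finFieldType) (chi : E -> C) (z2 b : E),
    [/\ p \in [pchar E], is_char chi, chi z2 != 1, b != 0
      & #|E| = (#|F| ^ 2)%N /\ klsum chi b = #|F|%:R *+ 2 - klsum psi a ^+ 2].
Proof.
move=> pF p2 psi_char z1N1 a0.
have F2 : (2 : F) != 0 by rewrite -(dvdn_pcharf pF) gtnNdvd.
have [E [iota oE]] := quadratic_extension F2.
have [z2 trz2] := qtrace_surj iota oE z1.
exists E, (psi \o qtrace iota oE), z2, (iota a); split.
- by rewrite (fmorph_pchar iota).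
- split; first by rewrite /= qtrace0 psi_char.1.
  by move=> x y /=; rewrite qtraceD psi_char.2.
- by rewrite /= trz2.
- by rewrite fmorph_eq0.
by split=> //; exact: klsum_quadratic z1N1 a0.
Qed.

(** Since [4 + d <= (2 + d / 4) ^ 2], the sum over [E] is at most [q (2 + d / 4)]; adding [2 q]
    gives the bound. *)
Lemma klsum_quadratic_bound (C : numFieldType) (F E : finFieldType) (d : C)
    (psi : F -> C) (a : F) (chi : E -> C) (b : E) :
  #|E| = (#|F| ^ 2)%N -> klsum chi b = #|F|%:R *+ 2 - klsum psi a ^+ 2 ->
  0 <= d -> `|klsum chi b| ^+ 2 <= #|E|%:R * (4 + d) ->
  `|klsum psi a| ^+ 2 <= #|F|%:R * (4 + d / 4).
Proof.
move=> oE eS d0 leE; set q : C := #|F|%:R in eS *.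
have q0 : 0 <= q by rewrite ler0n.
have d4 : 0 <= d / 4 by rewrite divr_ge0.
have {leE}: `|klsum chi b| <= q * (2 + d / 4).
  rewrite -(@ler_pXn2r _ 2) ?nnegrE ?mulr_ge0 ?addr_ge0 //.
  apply: le_trans leE _; rewrite oE natrX exprMn ler_wpM2l ?exprn_ge0 //.
  have -> : (2 + d / 4) ^+ 2 = 4 + d + (d / 4) ^+ 2 by field.
  by rewrite lerDl exprn_ge0.
have eS2 : klsum psi a ^+ 2 = q *+ 2 - klsum chi b by rewrite eS opprB addrC subrK.
move=> leE; rewrite -normrX eS2; apply: le_trans (ler_normB _ _) _.
rewrite ger0_norm ?mulrn_wge0 //; apply: le_trans (lerD (lexx _) leE) _.
by rewrite -[q *+ 2]mulr_natr -mulrDr addrA -natrD.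
Qed.

(** Each descent from a quadratic extension divides the excess over 4 by four. The initial excess
    depends on [p] only, so the induction ranges over all fields of characteristic [p]. *)
Lemma klsum_weil_approx (C : numFieldType) (p k : nat) (F : finFieldType)
    (psi : F -> C) (z1 a : F) :
  p \in [pchar F] -> (2 < p)%N -> is_char psi -> psi z1 != 1 -> a != 0 ->
  `|klsum psi a| ^+ 2 <= #|F|%:R * (4 + (2 * p + 1)%N%:R ^+ 2 / 4 ^+ k).
Proof.
set B : C := _%:R ^+ 2; move=> pF p2.
have B0 k' : 0 <= B / 4 ^+ k' by rewrite divr_ge0 ?exprn_ge0.
elim: k F psi z1 a pF => [|k IH] F psi z1 a pF psi_char z1N1 a0.
  (* Two extensions give [p ^ (4 n)] elements, that is [p ^ (2 (m + 1))] with [m = 2 n - 1 > 0], as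
     the crude bound requires. *)
  have [E [chi [z2 [b [pE chi_char z2N1 b0 [oE eS]]]]]] :=
    quadratic_lift pF p2 psi_char z1N1 a0.
  have [E' [chi' [z3 [b' [pE' chi'_char z3N1 b'0 [oE' eS']]]]]] :=
    quadratic_lift pE p2 chi_char z2N1 b0.
  have p_gt1 : (1 < p)%N := ltnW p2.
  have le_quarter (d : C) : 0 <= d -> 4 + d / 4 <= 4 + d.
    by move=> d0; rewrite lerD2l ler_pdivrMr // ler_peMr // ler1n.
  have := B0 0%N; rewrite expr0 divr1 => {}B0.
  apply: le_trans (ler_wpM2l (ler0n _ _) (le_quarter _ B0)).
  apply: (klsum_quadratic_bound oE eS B0).
  apply: le_trans (ler_wpM2l (ler0n _ _) (le_quarter _ B0)).
  apply: (klsum_quadratic_bound oE' eS' B0).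
  have oF := card_pprimeChar pF; set n := logn p #|F| in oF.
  have n0 : (0 < n)%N.
    by have := finNzRing_gt1 F; rewrite oF; case: n {oF}; rewrite ?expn0.
  have oE2 : #|E'| = (p ^ ((n + n).-1.+1 + (n + n).-1.+1))%N.
    rewrite prednK ?addn_gt0 ?n0 // oE' oE oF -!expnM; congr (_ ^ _)%N; lia.
  have m0 : (0 < (n + n).-1)%N by lia.
  have := klsum_crude b' pE' oE2 m0 chi'_char z3N1.
  rewrite [X in _ <= X -> _]natrD natrM => leS.
  set r : C := (p ^ (n + n).-1.+1)%:R in leS.
  have r1 : 1 <= r by rewrite ler1n expn_gt0 ltnW.
  have r0 : 0 <= r := le_trans ler01 r1.
  have {}leS : `|klsum chi' b'| <= (2 * p + 1)%N%:R * r.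
    by apply: le_trans leS _; rewrite natrD mulrDl lerD2l mul1r.
  have -> : (#|E'|%:R : C) = r ^+ 2 by rewrite oE2 expnD natrM expr2.
  apply: (@le_trans _ _ (((2 * p + 1)%N%:R * r) ^+ 2)).
    rewrite ler_pXn2r ?nnegrE ?mulr_ge0 //.
  rewrite exprMn mulrC ler_wpM2l ?exprn_ge0 //.
  by rewrite lerDr.
have [E [chi [z2 [b [pE chi_char z2N1 b0 [oE eS]]]]]] :=
  quadratic_lift pF p2 psi_char z1N1 a0.
have := klsum_quadratic_bound oE eS (B0 k) (IH _ _ _ _ pE chi_char z2N1 b0).
by rewrite [4 ^+ k.+1]exprSr invfM mulrA.
Qed.

(** * Norms of cyclotomic integers *)

Section CyclicShift.

Variable r : nat.

(** The matrix of a cyclic permutation; the polynomials in it are the circulant matrices. *)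
Definition shift_mx (R : nzRingType) : 'M[R]_r.+1 := \matrix_(i, j) (j == ordS i)%:R.

Lemma shift_mxXn (R : nzRingType) : shift_mx R ^+ r.+1 = 1.
Proof.
have H k i j : (shift_mx R ^+ k) i j = (j == iter k (@ordS _) i)%:R.
  elim: k i j => [|k IH] i j; first by rewrite expr0 mxE eq_sym.
  rewrite exprS mxE (bigD1 (ordS i)) //= big1 => [|l /negPf li].
    by rewrite IH mxE eqxx mul1r addr0 -iterSr.
  by rewrite mxE li mul0r.
apply/matrixP => i j; rewrite H mxE eq_sym.
suff -> : iter r.+1 (@ordS r.+1) i = i by [].
have vk k : val (iter k (@ordS _) i) = ((i + k) %% r.+1)%N.
  elim: k => [|k IH] /=; first by rewrite addn0 modn_small.
  by rewrite IH addnS -addn1 modnDml addn1.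
by apply: val_inj; rewrite vk modnDr modn_small.
Qed.

Lemma map_shift_mx (R S : nzRingType) (f : {rmorphism R -> S}) :
  map_mx f (shift_mx R) = shift_mx S.
Proof. by apply/matrixP => i j; rewrite !mxE rmorph_nat. Qed.

(** The columns of the Vandermonde matrix of the powers of [w] are eigenvectors of the shift. *)
Lemma det_horner_shift (C : fieldType) (w : C) (P : {poly C}) :
  r.+1.-primitive_root w ->
  \det (horner_mx (shift_mx C) P) = \prod_(j < r.+1) P.[w ^+ j].
Proof.
move=> pw; pose V : 'M[C]_r.+1 := Vandermonde r.+1 (\row_j w ^+ j).
have V0 : \det V != 0.
  rewrite det_Vandermonde; apply/prodf_neq0 => i _; apply/prodf_neq0 => j ij.
  rewrite !mxE subr_eq0 (eq_prim_root_expr pw) !modn_small //.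
  by rewrite neq_ltn ij orbT.
have shiftV : shift_mx C *m V = V *m diag_mx (\row_j w ^+ j).
  rewrite mul_mx_diag; apply/matrixP => i j; rewrite !mxE (bigD1 (ordS i)) //=.
  rewrite big1 => [|l /negPf li]; last by rewrite mxE li mul0r.
  rewrite !mxE eqxx mul1r addr0 -exprM mulnC exprM (prim_expr_mod pw) -!exprM.
  by rewrite -exprD mulSn addnC mulnC.
have hV : horner_mx (shift_mx C) P *m V = V *m diag_mx (\row_j P.[w ^+ j]).
  elim/poly_ind: P => [|P c IH].
    by rewrite rmorph0 mul0mx mul_mx_diag; apply/matrixP=> i j; rewrite !mxE horner0 mulr0.
  rewrite rmorphD rmorphM /= horner_mx_X horner_mx_C mulmxDl -mulmxA shiftV.
  rewrite mulmxA IH mul_scalar_mx !mul_mx_diag.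
  by apply/matrixP => i j; rewrite !mxE !hornerE; ring.
apply: (mulIf V0); rewrite -det_mulmx hV det_mulmx det_diag mulrC; congr (_ * _).
by apply: eq_bigr => j _; rewrite mxE.
Qed.

(* Modulo [p] one has [f ^ p = f(1) ^ p] at the cyclic shift, as [X^p - 1 = (X - 1)^p]. *)
Lemma det_horner_shift_pchar (f : {poly 'F_r.+1}) :
  prime r.+1 -> f.[1] != 0 -> \det (horner_mx (shift_mx 'F_r.+1) f) != 0.
Proof.
move=> pr f1; set S := shift_mx _.
have pF : r.+1 \in [pchar 'F_r.+1] by exact: pchar_Fp.
have pP : r.+1 \in [pchar {poly 'F_r.+1}] by rewrite pchar_poly.
have fp : f ^+ r.+1 = (f - f.[1]%:P) ^+ r.+1 + (f.[1] ^+ r.+1)%:P.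
  rewrite -[in LHS](subrK f.[1]%:P f) -[X in _ ^+ X]expn1 exprD_pchar_pow //.
  by rewrite !expn1 polyC_exp.
have [g fg] : exists g, f - f.[1]%:P = g * ('X - 1%:P).
  by apply/factor_theorem; rewrite rootE !hornerE subrr.
have X1 : ('X - 1%:P) ^+ r.+1 = 'X^(r.+1) - 1 :> {poly 'F_r.+1}.
  apply/eqP; rewrite eq_sym subr_eq eq_sym; apply/eqP.
  have := exprD_pchar_pow 1 ('X - 1%:P : {poly 'F_r.+1}) 1%:P pP.
  by rewrite subrK expn1 polyC1 expr1n => ->.
have hfp : horner_mx S f ^+ r.+1 = (f.[1] ^+ r.+1)%:M.
  rewrite -rmorphXn fp fg exprMn X1 rmorphD rmorphM rmorphB /= rmorph1.
  rewrite [horner_mx S 'X^_]rmorphXn /=.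
  by rewrite horner_mx_X shift_mxXn subrr mulr0 add0r horner_mx_C.
have : horner_mx S f ^+ r.+1 \is a GRing.unit.
  by rewrite hfp [_ \is a _]unitmxE det_scalar unitfE !expf_neq0.
by rewrite unitrX_pos // [_ \is a _]unitmxE unitfE.
Qed.

End CyclicShift.

(** The product is the absolute value of an integer determinant, which is nonzero because its
    reduction modulo [p] is. *)
Lemma cyclotomic_norm_ge1 (C : numFieldType) (p : nat) (w : C) (P : {poly int}) :
  prime p -> p.-primitive_root w -> (P.[1])%:~R != 0 :> 'F_p ->
  1 <= \prod_(j < p) `|(map_poly intr P).[w ^+ j]|.
Proof.
case: p => // r pr pw P1.
pose N := \det (horner_mx (shift_mx r int) P).
have hN (R : comNzRingType) : \det (horner_mx (shift_mx r R) (map_poly intr P)) = N%:~R.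
  by rewrite -det_map_mx map_horner_mx map_shift_mx.
have N0 : N != 0.
  have := @det_horner_shift_pchar r (map_poly intr P) pr.
  rewrite hN -(rmorph1 (intr : int -> 'F_r.+1)) horner_map => /(_ P1).
  by apply: contra_neq => ->.
rewrite -normr_prod -det_horner_shift // hN -intr_norm ler1z.
by rewrite -gtz0_ge1 normr_gt0.
Qed.

(** * The lower bound for [4 q - Kl ^ 2] *)

(** Replacing [x] by [- x] conjugates every term. *)
Lemma klsum_real (C : numClosedFieldType) (F : finFieldType) (p : nat)
    (psi : F -> C) (a : F) :
  p \in [pchar F] -> is_char psi -> klsum psi a \is Num.real.
Proof.
move=> pF psi_char; apply/CrealP; rewrite /klsum rmorph_sum /=.
rewrite [RHS](reindex_inj oppr_inj) /=.
apply: eq_big => [x|x _]; first by rewrite oppr_eq0.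
rewrite invrN mulrN -opprD; move: (x + a / x) => y.
have y1 : psi y * (psi y)^* = 1 by rewrite -normCK (char_norm pF psi_char) expr1n.
by rewrite -[RHS]mulr1 -y1 mulrA (charN psi_char) mul1r.
Qed.

Lemma prime_prim_root (C : fieldType) (p : nat) (w : C) :
  prime p -> w ^+ p = 1 -> w != 1 -> p.-primitive_root w.
Proof.
move=> pr wp w1; have [m mw mp] := prim_order_exists (prime_gt0 pr) wp.
have /primeP[_ /(_ _ mp) /orP[/eqP m1|/eqP <- //]] := pr.
by have := prim_expr_order mw; rewrite m1 expr1 => /eqP; rewrite (negPf w1).
Qed.

(** At [w ^ j] the polynomial [P] takes the value belonging to the character [psi ^ j]. In the
    product, [j = 0] contributes at most [q ^ 2], [j = 1] the quantity sought, and the other [p - 2]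
    factors at most [4 q] each. *)
Lemma klsum_gap (C : numClosedFieldType) (F : finFieldType) (p : nat)
    (psi : F -> C) (z1 a : F) :
  p \in [pchar F] -> (2 < p)%N -> is_char psi -> psi z1 != 1 ->
  (forall (chi : F -> C) z, is_char chi -> chi z != 1 ->
     `|klsum chi a| ^+ 2 <= 4 * #|F|%:R) ->
  1 <= (4 * #|F|%:R - klsum psi a ^+ 2) * (4 * #|F|%:R) ^+ (p - 2) * #|F|%:R ^+ 2.
Proof.
move=> pF p2 psi_char z1N1 weil; set q : C := #|F|%:R.
have pr := pcharf_prime pF; pose w := psi z1.
have pw : p.-primitive_root w.
  by apply: prime_prim_root => //; exact: char_pchar.
pose l y := sval (prim_rootP pw (char_pchar psi_char y pF)).
have lE y : psi y = w ^+ l y by exact: svalP (prim_rootP pw (char_pchar psi_char y pF)).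
pose P : {poly int} := (4 * #|F|)%:R - (\sum_(x : F | x != 0) 'X^(l (x + a / x)%R)) ^+ 2.
pose chi (j : nat) y := psi y ^+ j.
have chi_char j : is_char (chi j).
  split; first by rewrite /chi psi_char.1 expr1n.
  by move=> x y; rewrite /chi psi_char.2 exprMn.
have PE (j : nat) : (map_poly intr P).[w ^+ j] = 4 * q - klsum (chi j) a ^+ 2.
  rewrite rmorphB rmorph_nat rmorphXn rmorph_sum /= !hornerE horner_sum.
  congr (_ - _ ^+ 2); first by rewrite hornerMn hornerC natrM.
  apply: eq_bigr => x _.
  by rewrite map_polyXn hornerXn /chi lE -!exprM mulnC.
have n0 : (0 < #|F|)%N by exact: ltnW (finNzRing_gt1 F).
have P1 : P.[1] = (4 * #|F|)%:R - (#|F| - 1)%:R ^+ 2.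
  rewrite !hornerE horner_sum; congr (_ - _ ^+ 2); first by rewrite hornerMn hornerC.
  rewrite (eq_bigr (fun=> 1)) => [|x _]; last by rewrite hornerXn expr1n.
  by rewrite sumr_const subn1 -(cardC1 (0 : F)).
have oF := card_pprimeChar pF.
have nF : (0 < logn p #|F|)%N.
  by have := finNzRing_gt1 F; rewrite [X in (1 < X)%N]oF; case: logn.
have q3 : (3 <= #|F|)%N.
  apply: leq_trans p2 _; rewrite oF -[X in (X <= _)%N]expn1 leq_exp2l ?prime_gt1 //.
have := @cyclotomic_norm_ge1 C p w P pr pw.
have -> : (P.[1])%:~R != 0 :> 'F_p.
  (* As [p] divides [q], the value [4 q - (q - 1) ^ 2] is [-1] modulo [p]. *)
  have q0 : #|F|%:R = 0 :> 'F_p.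
    apply/eqP; rewrite -(dvdn_pcharf (pchar_Fp pr)) oF.
    by rewrite -[X in (X %| _)%N]expn1 dvdn_exp2l.
  rewrite P1 rmorphB rmorphXn /= !rmorph_nat natrM natrB // q0 mulr0 !sub0r.
  by rewrite sqrrN expr1n oppr_eq0 oner_eq0.
move=> /(_ isT) /le_trans; apply.
have q0 : 0 <= q by rewrite ler0n.
have chiR j : klsum (chi j) a \is Num.real by exact: klsum_real pF (chi_char j).
have gap_j (j : nat) : (0 < j < p)%N -> 0 <= 4 * q - klsum (chi j) a ^+ 2 <= 4 * q.
  move=> /andP[j0 jp]; have chiN1 : chi j z1 != 1.
    by rewrite /chi -/w -(prim_order_dvd pw) gtnNdvd.
  have := weil _ z1 (chi_char j) chiN1; rewrite real_normK // => le4.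
  by rewrite subr_ge0 le4 lerBlDr lerDl real_exprn_even_ge0.
have psiE : klsum (chi 1%N) a = klsum psi a.
  by apply: eq_bigr => x _; rewrite /chi expr1.
(* The bound [4 q - (q - 1) ^ 2 <= q ^ 2] holds from [q = 3] on. *)
have gap0 : `|(map_poly intr P).[w ^+ 0]| <= q ^+ 2.
  rewrite expr0 -(rmorph1 (intr : int -> C)) horner_map /= -intr_norm.
  rewrite -natrX -[X in _ <= X]mulrz_nat ler_int P1.
  by move: #|F| q3 => f; nia.
under eq_bigr do rewrite PE.
rewrite PE -psiE in gap0 *.
move: p2 gap_j; case: (p) => [|[|r]] // _ gap_j.
rewrite !big_ord_recl /= [X in _ <= X]mulrC !subSS subn0.
have nn (y : C) : 0 <= `|y| by exact: normr_ge0.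
have /andP[g1 _] := gap_j 1%N isT; rewrite -psiE.
apply: ler_pM => //; first by rewrite mulr_ge0 ?prodr_ge0.
apply: ler_pM => //; first by rewrite prodr_ge0.
  by rewrite ger0_norm.
rewrite -[r in X in _ <= X]card_ord -prodr_const; apply: ler_prod => j _.
rewrite nn /=; have /andP[gj0 gj] := gap_j j.+2 (ltn_ord j).
by rewrite ger0_norm.
Qed.

(** * The angle *)

(** As [R] is archimedean, the error term [B / 4 ^ k] falls below any positive excess over 4. *)
Lemma klsum_weil (R : realType) (p : nat) (F : finFieldType) (psi : F -> R[i]) (z1 a : F) :
  p \in [pchar F] -> (2 < p)%N -> is_char psi -> psi z1 != 1 -> a != 0 ->
  `|klsum psi a| ^+ 2 <= 4 * #|F|%:R.
Proof.
move=> pF p2 psi_char z1N1 a0.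
pose x : R := complex.Re (klsum psi a) ^+ 2 + complex.Im (klsum psi a) ^+ 2.
have xE : `|klsum psi a| ^+ 2 = (x%:C)%C by rewrite add_Re2_Im2.
pose B : R := (2 * p + 1)%N%:R ^+ 2; pose q : R := #|F|%:R.
have q0 : 0 < q by rewrite ltr0n ltnW ?finNzRing_gt1.
have approx k : x <= q * (4 + B / 4 ^+ k).
  have := klsum_weil_approx k pF p2 psi_char z1N1 a0; rewrite xE.
  by rewrite -lecR !(rmorphM, rmorphD, fmorphV, rmorphXn, rmorph_nat).
rewrite xE -[4 * _]natrM -(rmorph_nat (real_complex R)) lecR natrM -/q.
rewrite leNgt; apply/negP => gtx.
pose e := (x / q - 4) / B.
have B0 : 0 < B by rewrite exprn_gt0 // ltr0n addn1.
have e0 : 0 < e by rewrite divr_gt0 // subr_gt0 ltr_pdivlMr.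
have := approx (Num.truncn e^-1).+1; set k := (Num.truncn e^-1).+1.
apply/negP; rewrite -ltNge.
have kE : e^-1 < 4 ^+ k.
  apply: (@lt_le_trans _ _ k%:R); first exact: truncnS_gt.
  by rewrite -natrX ler_nat ltnW // ltn_expl.
have {}kE : (4 ^+ k)^-1 < e by rewrite invf_plt ?posrE ?exprn_gt0.
rewrite mulrC -ltr_pdivlMr // -ltrBrDl mulrC -ltr_pdivlMr //.
Qed.

Lemma sin_le (R : realType) (x : R) : 0 <= x -> sin x <= x.
Proof.
move=> x0.
have [|c _] := @MVT_segment R (@sin R) (@cos R) 0 x x0 (fun y _ => is_derive_sin y).
  by apply/continuous_in_subspaceT => ? ?; exact: continuous_sin.
by rewrite sin0 !subr0 => ->; rewrite ler_piMl // cos_le1.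
Qed.

(** The angle and its supplement have the same sine [sqrt (1 - y ^ 2)], which exceeds [e] and is at
    most either of them. *)
Lemma acos_far_from_ends (R : realType) (y e : R) :
  0 < e -> e ^+ 2 < 1 - y ^+ 2 -> `|acos y| > e /\ `|pi - acos y| > e.
Proof.
move=> e0 ey.
have e20 : 0 < e ^+ 2 by rewrite exprn_gt0.
have y1 : -1 <= y <= 1.
  by rewrite -ler_norml -(@ler_pXn2r _ 2) ?nnegrE // expr1n real_normK ?num_real //; lra.
have sy : e < sin (acos y).
  rewrite sin_acos // -(@ltr_pXn2r _ 2) ?nnegrE ?sqrtr_ge0 ?(ltW e0) //.
  by rewrite sqr_sqrtr //; lra.
have a0 := acos_ge0 y1; have api : 0 <= pi - acos y by rewrite subr_ge0 acos_lepi.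
rewrite !ger0_norm //; split; apply: (lt_le_trans sy); first exact: sin_le.
apply: le_trans (sin_le api).
by rewrite sinB sinpi cospi mul0r sub0r mulN1r opprK.
Qed.

Theorem theorem4p1 (R : realType) (p : nat) (F : finFieldType)
    (psi : F -> R[i]) (alpha : F) :
  prime p -> (3 <= p)%N -> p \in [pchar F] ->
  additive_character psi -> nontrivial_character psi ->
  alpha != 0 ->
  let c := (2 * (p - 1))%N in
  `|kl_angle psi alpha| > (#|F|%:R : R) ^- c /\
  `|pi - kl_angle psi alpha| > (#|F|%:R : R) ^- c.
Proof.
move=> pr p3 pF psi_char [z1 z1N1] a0 c.
have psi_char' : is_char psi := psi_char.
pose q : R := #|F|%:R; pose k := complex.Re (klsum psi alpha).
have kE : (k%:C)%C = klsum psi alpha.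
  by apply: RRe_real; exact: klsum_real pF psi_char'.
have gap : 1 <= (4 * q - k ^+ 2) * (4 * q) ^+ (p - 2) * q ^+ 2.
  have := klsum_gap pF p3 psi_char' z1N1
    (fun chi z chi_char zN1 => klsum_weil pF p3 chi_char zN1 a0).
  rewrite -kE -lecR.
  by rewrite !(rmorphM, rmorphB, rmorphXn, rmorph_nat, rmorph1).
have ReK : complex.Re (Kloosterman psi alpha) = - k.
  by rewrite -[Kloosterman _ _]/(- klsum psi alpha) -kE.
rewrite /kl_angle ReK -/q.
have q3 : 3 <= q.
  rewrite ler_nat; apply: leq_trans p3 _; rewrite (card_pprimeChar pF).
  rewrite -[X in (X <= _)%N]expn1 leq_exp2l ?prime_gt1 //.
  by have := finNzRing_gt1 F; rewrite [X in (1 < X)%N](card_pprimeChar pF); case: logn.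
have q0 : 0 < q by lra.
apply: acos_far_from_ends; first by rewrite invr_gt0 exprn_gt0.
have -> : (- k / (2 * Num.sqrt q)) ^+ 2 = k ^+ 2 / (4 * q).
  by rewrite exprMn sqrrN exprVn exprMn sqr_sqrtr ?(ltW q0) // -natrX.
have -> : 1 - k ^+ 2 / (4 * q) = (4 * q - k ^+ 2) / (4 * q).
  by field; rewrite gt_eqF.
rewrite exprVn -exprM /c ltr_pdivlMr ?mulr_gt0 // mulrC ltr_pdivrMr ?exprn_gt0 //.
set g := 4 * q - k ^+ 2 in gap *.
have q40 : 0 < 4 * q by rewrite mulr_gt0.
have g0 : 0 < g.
  rewrite ltNge; apply/negP => g0; move: gap; apply/negP; rewrite -ltNge.
  apply: le_lt_trans ltr01; rewrite -mulrA; apply: mulr_le0_ge0 => //.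
  by rewrite mulr_ge0 ?exprn_ge0 ?(ltW q0) ?(ltW q40).
(* Squaring doubles the exponent [c] to [4 (p - 1)]: of this, [3 (p - 1)] absorbs [(4 q) ^ (p - 1)]
   because [4 q < q ^ 3], and [p - 1 >= 2] absorbs [q ^ 2]. *)
have W : (4 * q) ^+ (p - 1) * q ^+ 2 < q ^+ (2 * (p - 1) * 2).
  have -> : (2 * (p - 1) * 2 = 3 * (p - 1) + (p - 1))%N by lia.
  rewrite exprD exprM; apply: (@lt_le_trans _ _ ((q ^+ 3) ^+ (p - 1) * q ^+ 2)).
    rewrite ltr_pM2r ?exprn_gt0 // ltr_pXn2r ?nnegrE ?exprn_ge0 ?(ltW q0) ?(ltW q40) //.
      by nra.
    by rewrite subn_gt0 ltnW.
  rewrite ler_wpM2l ?exprn_ge0 ?(ltW q0) // ler_weXn2l //; last by lia.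
  by lra.
apply: (@le_lt_trans _ _ (g * ((4 * q) ^+ (p - 1) * q ^+ 2))).
  have -> : (p - 1 = (p - 2).+1)%N by lia.
  have -> : g * ((4 * q) ^+ (p - 2).+1 * q ^+ 2)
      = 4 * q * (g * (4 * q) ^+ (p - 2) * q ^+ 2) by rewrite exprS; ring.
  by rewrite ler_peMr // ltW.
by rewrite ltr_pM2l.
Qed.
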